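(* Let $a,b\ge2$ be integers. The chromatic symmetric function of $C_a+C_b$ (two cycles, with $a$ and $b$ vertices, sharing exactly one vertex) is $$X_{C_a+C_b}(\boldsymbol{x})=\sum_{\substack{\alpha\models a,\ \beta\models b+\alpha_1\\ \mathrm{len}(\beta)\ge 2,\ \beta_1\le \alpha_1,\ \beta_2\ge \alpha_1}}(\alpha_1-1)\cdots(\alpha_l-1)\cdot(\beta_2-\beta_1+1)(\beta_1+\beta_2-\alpha_1-1)\cdot(\beta_3-1)\cdots(\beta_l-1)\cdot e_{\mathrm{sort}(\alpha\setminus\alpha_1\,\cdot\,\beta\setminus\beta_1\,\cdot\,(\beta_1-1))}.$$
   Context: $C_a$ is the cycle graph on $\{1,\dots,a\}$ with edges $(1,2),(2,3),\dots,(a-1,a),(a,1)$ (for $a=2$ this is a single edge). If $G_1,G_2$ are graphs with vertices labeled $1,\dots,k_1$ and $1,\dots,k_2$, then $G_1+G_2$ is the graph on $\{1,\dots,k_1+k_2-1\}$ with edge set $E(G_1)\cup\{(i+k_1-1,j+k_1-1):(i,j)\in E(G_2)\}$, i.e. the last vertex of $G_1$ is identified with the first vertex of $G_2$. The chromatic symmetric function of a graph $G$ is $X_G(\boldsymbol{x})=\sum_\kappa\prod_{v\in V(G)}x_{\kappa(v)}$, summed over proper colorings $\kappa:V(G)\to\mathbb{N}$, in infinitely many variables $\boldsymbol{x}=(x_i)_{i\in\mathbb{N}}$. $e_k=\sum_{i_1<\cdots<i_k}x_{i_1}\cdots x_{i_k}$, $e_0=1$, and $e_\lambda=\prod_i e_{\lambda_i}$.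 $\alpha\models n$ means that $\alpha=(\alpha_1,\dots,\alpha_l)$ is a composition of $n$ (a tuple of positive integers with sum $n$); $\mathrm{len}(\alpha)$ is its number of parts. The subscript $l$ always denotes the last index of the composition in question (so $\alpha_l$ and $\beta_l$ are the last parts of $\alpha$ and $\beta$, whose lengths may differ). $\alpha\setminus\alpha_1$ is $\alpha$ with its first part deleted, $\cdot$ between tuples is concatenation, $\mathrm{sort}$ rearranges a tuple in weakly decreasing order, and a part equal to $0$ (occurring when $\beta_1=1$) contributes the factor $e_0=1$. Empty products equal $1$ (e.g. $(\beta_3-1)\cdots(\beta_l-1)=1$ when $\mathrm{len}(\beta)=2$). *)

(* Defs.v *)
From HB Require Import structures.
From mathcomp Require Import all_boot all_order all_algebra.
From mathcomp Require Import finmap multiset.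
From mathcomp Require Import boolp classical_sets functions cardinality fsbigop.

Set Implicit Arguments.
Unset Strict Implicit.
Unset Printing Implicit Defensive.

Import Order.TTheory GRing.Theory Num.Theory.
Local Open Scope mset_scope.
Local Open Scope classical_set_scope.
Local Open Scope ring_scope.

(* Formal power series with integer coefficients in the variables x_i, i : nat.
   The monomial prod_i x_i^(m i) is the multiset m, so the product of two
   monomials is the multiset sum; f m is the coefficient of m in f. The
   product below is the Cauchy product, not the pointwise product of
   functions. *)
Definition fps : Type := {mset nat} -> int.

HB.instance Definition _ := GRing.Zmodule.copy fps ({mset nat} -> int).

Definition mset_splits (m : {mset nat}) : set ({mset nat} * {mset nat}) :=
  [set p | p.1 `+` p.2 = m]%mset.

Definition fps_one : fps := fun m => (m == mset0)%:R.

Definition fps_mul (f g : fps) : fps :=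
  fun m => \sum_(p \in mset_splits m) f p.1 * g p.2.

Section FpsRing.
Implicit Types (f g h : fps) (m A B C : {mset nat}).

Let sub_of m (u : {ffun finsupp m -> 'I_(size m).+1}) : {mset nat} :=
  [fsfun x : finsupp m => nat_of_ord (u x) | 0%N].

Lemma finite_submset m : finite_set [set A : {mset nat} | (A `<=` m)%mset].
Proof.
apply: (@sub_finite_set _ _ (range (@sub_of m))); last first.
  by apply: finite_image; exact: finite_finset.
move=> A /= /msubsetP leAm.
have lt_m x : (A x < (size m).+1)%N.
  rewrite ltnS (leq_trans (leAm x)) //.
  by rewrite -count_mem_mset count_size.
exists [ffun x => Ordinal (lt_m (val x))] => //.
apply/msetP => x; rewrite /sub_of fsfun_ffun
; case: insubP => [y _ <-|xm] /=; first by rewrite ffunE.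
apply/esym/eqP; rewrite -leqn0 (leq_trans (leAm x)) //.
by rewrite (fsfun_dflt xm).
Qed.

Definition submsets m : seq {mset nat} :=
  fset_set [set A : {mset nat} | (A `<=` m)%mset].

Lemma submsets_uniq m : uniq (submsets m). Proof. exact: fset_uniq. Qed.

Lemma mem_submsets m A : (A \in submsets m) = (A `<=` m)%mset.
Proof.
rewrite /submsets in_fset_set; last exact: finite_submset.
by apply/idP/idP; rewrite inE.
Qed.

Lemma mem_submsetsDl m A B C :
  (A `+` B = C)%mset -> C \in submsets m -> A \in submsets m.
Proof.
move=> <-; rewrite !mem_submsets => /msubsetP le_m; apply/msubsetP => x.
by apply: leq_trans (le_m x); rewrite msetE2 leq_addr.
Qed.

Lemma mem_submsetsDr m A B C :
  (A `+` B = C)%mset -> C \in submsets m -> B \in submsets m.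
Proof. by rewrite msetDC; exact: mem_submsetsDl. Qed.

Lemma submsets_id m : m \in submsets m.
Proof. by rewrite mem_submsets; apply/msubsetP. Qed.

Lemma fps_mulE f g m n : n \in submsets m ->
  fps_mul f g n =
  \sum_(A <- submsets m) \sum_(B <- submsets m | (A `+` B)%mset == n) f A * g B.
Proof.
move=> nm; rewrite /fps_mul.
pose s := [seq p <- [seq (A, B) | A <- submsets m, B <- submsets m]
             | (p.1 `+` p.2)%mset == n].
have us : uniq s.
  apply/filter_uniq/allpairs_uniq; rewrite ?submsets_uniq //.
  by move=> [? ?] [? ?] /= _ _.
have -> : mset_splits n = [set` s].
  apply/seteqP; split => -[A B] /=; rewrite /mset_splits /= mem_filter /=.
    move=> AB; rewrite AB eqxx; apply/allpairsP; exists (A, B); split => //=.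
      exact: mem_submsetsDl AB nm.
    exact: mem_submsetsDr AB nm.
  by case/andP=> /eqP.
rewrite -fsbig_seq // big_filter big_mkcond big_allpairs.
by apply: eq_bigr => A _; rewrite [RHS]big_mkcond.
Qed.

Lemma fps_mulC : commutative fps_mul.
Proof.
move=> f g; apply/funext => m; rewrite !(fps_mulE _ _ (submsets_id m)).
rewrite (exchange_big_dep xpredT) //=; apply: eq_bigr => B _.
by apply: eq_big => [A|A _]; [rewrite msetDC | rewrite mulrC].
Qed.

Lemma fps_mul1r : left_id fps_one fps_mul.
Proof.
move=> f; apply/funext => m; rewrite (fps_mulE _ _ (submsets_id m)).
have m0 : mset0 \in submsets m by rewrite mem_submsets msub0set.
rewrite (bigD1_seq mset0) ?submsets_uniq //= [X in _ + X]big1 => [|A A0]; last first.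
  by rewrite big1 // => B _; rewrite /fps_one (negbTE A0) mul0r.
rewrite addr0 (eq_bigl (pred1 m)) => [|B]; last by rewrite mset0D.
rewrite -big_filter filter_pred1_uniq ?submsets_uniq ?submsets_id //.
by rewrite big_seq1 /fps_one eqxx mul1r.
Qed.

Lemma fps_mulDl : left_distributive fps_mul +%R.
Proof.
move=> f g h; apply/funext => m.
rewrite [RHS]/GRing.add /= !(fps_mulE _ _ (submsets_id m)) -big_split /=.
apply: eq_bigr => A _; rewrite -big_split /=; apply: eq_bigr => B _.
by rewrite -mulrDl.
Qed.

Lemma fps_mulA : associative fps_mul.
Proof.
have E f g h m : fps_mul f (fps_mul g h) m =
    \sum_(A <- submsets m) \sum_(B <- submsets m)
      \sum_(C <- submsets m | (A `+` (B `+` C))%mset == m) f A * (g B * h C).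
  rewrite (fps_mulE _ _ (submsets_id m)); apply: eq_bigr => A _.
  rewrite big_mkcond /= (eq_big_seq (fun D => \sum_(B <- submsets m)
      \sum_(C <- submsets m) if ((A `+` D)%mset == m) && ((B `+` C)%mset == D)
                             then f A * (g B * h C) else 0)) => [|D Dm].
  2:{ case: ifP => _ /=; last by rewrite big1 // => B _; rewrite big1.
    rewrite (fps_mulE _ _ Dm) mulr_sumr; apply: eq_bigr => B _.
    by rewrite mulr_sumr big_mkcond. }
  rewrite exchange_big /=; apply: eq_bigr => B _.
  rewrite exchange_big [RHS]big_mkcond /=; apply: eq_bigr => C _.
  case: ifP => [/eqP ABC|ABC]; last first.
    rewrite big1 // => D _; case: ifP => // /andP[AD /eqP BC].
    by rewrite BC AD in ABC.
  rewrite (bigD1_seq (B `+` C)%mset) ?submsets_uniq //=; last first.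
    exact: mem_submsetsDr ABC (submsets_id m).
  rewrite ABC !eqxx big1 ?addr0 // => D /negbTE.
  by rewrite eq_sym => ->; rewrite andbF.
move=> f g h; apply/funext => m; rewrite (fps_mulC (fps_mul f g)) !E.
under eq_bigr => A _.
  under eq_bigr => B _ do rewrite big_mkcond.
  over.
under [RHS]eq_bigr => A _.
  under eq_bigr => B _ do rewrite big_mkcond.
  over.
rewrite [RHS]exchange_big /=; under [RHS]eq_bigr do rewrite exchange_big /=.
apply: eq_bigr => A _; apply: eq_bigr => B _; apply: eq_bigr => C _.
rewrite [in RHS]msetDC -msetDA.
by case: ifP => // _; rewrite [RHS]mulrC mulrA.
Qed.

Lemma fps_one_neq0 : fps_one != 0.
Proof.
by apply/eqP => /(congr1 (fun f : fps => f mset0)); rewrite /fps_one eqxx.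
Qed.

End FpsRing.

HB.instance Definition _ := GRing.Zmodule_isComNzRing.Build fps
  fps_mulA fps_mulC fps_mul1r fps_mulDl fps_one_neq0.

Definition fps_var (i : nat) : fps := fun m => (m == [mset i]%mset)%:R.

(* Sum of a possibly infinite family of series, coefficient by coefficient.
   In the uses below only finitely many members of the family have a nonzero
   coefficient at any given monomial, so the finitely supported sum on the
   right never takes its default value. *)
Definition fps_sum (I : choiceType) (D : set I) (F : I -> fps) : fps :=
  fun m => \sum_(i \in D) F i m.

Definition elem (k : nat) : fps :=
  fps_sum [set A : {fset nat} | #|` A|%fset = k]
    (fun A => \prod_(i <- A) fps_var i).

Definition elem_part (la : seq nat) : fps := \prod_(k <- la) elem k.

(* A graph with vertices labelled 1, ..., k is given by its adjacency relation
   on 'I_k; the vertex labelled i is the ordinal i - 1. *)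
Definition proper_coloring (k : nat) (e : rel 'I_k) (kappa : {ffun 'I_k -> nat}) :=
  forall u v : 'I_k, e u v -> kappa u != kappa v.

Definition chromatic_sym (k : nat) (e : rel 'I_k) : fps :=
  fps_sum [set kappa | proper_coloring e kappa]
    (fun kappa => \prod_(v < k) fps_var (kappa v)).

(* ordS is the cyclic successor. Meant for a >= 2 (there is a loop at a = 1). *)
Definition cycle_graph (a : nat) : rel 'I_a :=
  [rel u v | (v == ordS u) || (u == ordS v)].
Arguments cycle_graph a : clear implicits.

Definition glue_graph (k1 k2 : nat) (e1 : rel 'I_k1) (e2 : rel 'I_k2) :
    rel 'I_(k1 + k2).-1 :=
  [rel u v : 'I_(k1 + k2).-1 |
       [exists i : 'I_k1, exists j : 'I_k1,
          [&& e1 i j, u == i :> nat & v == j :> nat]]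
    || [exists i : 'I_k2, exists j : 'I_k2,
          [&& e2 i j, u == (i + k1.-1)%N :> nat & v == (j + k1.-1)%N :> nat]]].

Definition is_composition (n : nat) (s : seq nat) : bool :=
  all (leq 1) s && (sumn s == n).

(* The i-th part of a composition, with i counted from 1. *)
Definition part (s : seq nat) (i : nat) : nat := nth 0%N s i.-1.

(* (s_i - 1) ... (s_l - 1), where s_l is the last part. *)
Definition prod_pred_from (i : nat) (s : seq nat) : int :=
  \prod_(i <= j < (size s).+1) ((part s j)%:Z - 1).

(* Main.v *)
Require Import Defs.
From HB Require Import structures.
From mathcomp Require Import all_boot all_order all_algebra.
From mathcomp Require Import finmap multiset.
From mathcomp Require Import boolp classical_sets functions cardinality fsbigop.
From mathcomp Require Import ring zify.

Import Order.TTheory GRing.Theory Num.Theory.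
Local Open Scope classical_set_scope.
Local Open Scope ring_scope.

(* A coefficient of a symmetric series involves finitely many variables, so one
   may work with x_i, i < N, in a commutative ring.  Fix the color c of the
   shared vertex, let r_k be the elementary symmetric polynomials in the
   variables other than x_c, let E(t) = sum_k e_k t^k, D = E - t E', and let h_n
   be the coefficient of t^n in 1/D, i.e. the sum over alpha |= n of
   prod_i (alpha_i - 1) e_(alpha_i).  The proper colorings of C_a with one vertex
   colored c have total weight x_c G_a(c), where the transfer matrix gives
   G_a(c) = sum_k k r_k h_(a-1-k).  Hence
     X = sum_c x_c G_a(c) G_b(c)
       = sum_(j,k) j k h_(a-1-j) h_(b-1-k) sum_c x_c r_j r_k,
   and the inner sum telescopes to
     sum_(i <= min(j,k)) (j + k + 1 - 2 i) e_(j+k+1-i) e_i.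
   The substitution alpha_1 = j + 1, beta_1 = i + 1, beta_2 = j + k + 1 - i turns
   this into the sum over pairs of compositions. *)

(** * Elementary symmetric polynomials with variables omitted *)

Section FiniteVariables.
Set Implicit Arguments.
Unset Strict Implicit.
Variables (R : comNzRingType) (I : finType) (x : I -> R).
Implicit Types (A : {set I}) (c d : I).

Definition epoly A : {poly R} := \prod_(i in A) (1 + (x i)%:P * 'X).

Definition esymv k : R := (epoly [set: I])`_k.

(** This is r_k of the overview, and [esymv] is e_k. *)
Definition esymvD c k : R := (epoly (~: [set c]))`_k.

Lemma epolyD1 A i : i \in A ->
  epoly A = (1 + (x i)%:P * 'X) * epoly (A :\ i).
Proof. exact: big_setD1. Qed.

(** Product rule: each factor has constant derivative x_i, and the induction peels off one factor at
    a time. *)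
Lemma deriv_epoly A :
  (epoly A)^`() = \sum_(i in A) (x i)%:P * epoly (A :\ i).
Proof.
have [n] := ubnP #|A|; elim: n A => // n IH A leA.
have [->|[i iA]] := set_0Vmem A.
  by rewrite big_set0 /epoly big_set0 derivC.
rewrite (big_setD1 i iA) (epolyD1 iA) derivM IH; last first.
  by move: leA; rewrite (cardsD1 i) iA.
rewrite derivD derivM !derivC derivX mul0r !add0r mulr1 mulr_sumr.
congr (_ + _); apply: eq_bigr => j.
rewrite !inE => /andP[ji jA].
rewrite mulrCA; congr (_ * _).
rewrite (@epolyD1 (A :\ j) i) ?inE 1?eq_sym ?ji //.
by congr (_ * epoly _); apply/setP => k; rewrite !inE andbCA.
Qed.

Lemma epoly0 A : (epoly A)`_0 = 1.
Proof.
rewrite -horner_coef0 /epoly horner_prod big1 // => i _.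
by rewrite hornerD hornerM hornerX mulr0 hornerC addr0.
Qed.

Lemma esymv0 : esymv 0 = 1. Proof. exact: epoly0. Qed.

Lemma esymvD0 c : esymvD c 0 = 1. Proof. exact: epoly0. Qed.

Lemma epolyT c :
  epoly [set: I] = (1 + (x c)%:P * 'X) * epoly (~: [set c]).
Proof. by rewrite (@epolyD1 _ c) ?inE // finset.setTD. Qed.

Lemma esymvS c k : esymv k.+1 = esymvD c k.+1 + x c * esymvD c k.
Proof.
by rewrite /esymv (epolyT c) mulrDl mul1r coefD -mulrA coefCM coefXM.
Qed.

(** Both sides are the coefficient of t^k in E', which the product rule writes as a sum over the
    omitted variable. *)
Lemma sum_esymvD k : \sum_c x c * esymvD c k = esymv k.+1 *+ k.+1.
Proof.
rewrite /esymv -coef_deriv deriv_epoly coef_sum.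
by apply: eq_big => [c|c _]; rewrite ?inE // coefCM finset.setTD.
Qed.

Definition esymvD2 (j k : nat) : R := \sum_c x c * esymvD c j * esymvD c k.

Lemma esymvD2C j k : esymvD2 j k = esymvD2 k j.
Proof. by apply: eq_bigr => c _; rewrite mulrAC. Qed.

(* With r_k := esymvD c k, write x_c r_j = e_(j+1) - r_(j+1) on the left and
   x_c r_k = e_(k+1) - r_(k+1) on the right: the terms r_(j+1) r_(k+1) cancel. *)
Lemma esymvD2S j k : esymvD2 j k.+1 =
  esymvD2 j.+1 k + esymv j.+1 * esymv k.+1 * (j%:R - k%:R).
Proof.
apply/eqP; rewrite addrC -subr_eq; apply/eqP.
transitivity (esymv k.+1 * (\sum_c x c * esymvD c j)
              - esymv j.+1 * (\sum_c x c * esymvD c k)).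
  rewrite /esymvD2 !mulr_sumr -!sumrB; apply: eq_bigr => c _.
  by rewrite (esymvS c j) (esymvS c k); ring.
by rewrite !sum_esymvD; ring.
Qed.

(** Repeated use of [esymvD2S] lowers the second index to 0, where r_0 = 1 leaves [sum_esymvD]; each
    application contributes one summand. *)
Lemma esymvD2E j k : esymvD2 j k =
  \sum_(i < k.+1) esymv (j + k - i).+1 * esymv i * ((j + k).+1%:R - i.*2%:R).
Proof.
elim: k j => [|k IH] j.
  rewrite big_ord1 addn0 subn0 esymv0 /esymvD2.
  under eq_bigr do rewrite esymvD0 mulr1.
  by rewrite sum_esymvD mulr1 subr0 mulr_natr.
rewrite esymvD2S IH [RHS]big_ord_recr /= addSnnS; congr (_ + _).
have -> : (j + k.+1 - k.+1 = j)%N by lia.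
by rewrite -addnn -!natr1 !natrD -!natr1; ring.
Qed.

(* The generating function of the walks from d to c, by number of interior
   vertices, is walk_num d c / edenom. *)
Definition walk_num d c : {poly R} :=
  if d == c then 'X * (epoly (~: [set c]))^`() else epoly (~: [set c] :\ d).

Definition edenom : {poly R} := epoly [set: I] - 'X * (epoly [set: I])^`().

(** First-step recursion W(d,c) = [d <> c] + t sum_(k <> d) x_k W(k,c) of the walk series,
    multiplied by the denominator D = [edenom]. *)
Lemma walk_num_rec d c :
  'X * (\sum_(k | k != d) (x k)%:P * walk_num k c)
  = walk_num d c - edenom *+ (d != c).
Proof.
have dE : \sum_(k | k != c) (x k)%:P * walk_num k c = (epoly (~: [set c]))^`().
  rewrite deriv_epoly; apply: eq_big => [k|k kc]; first by rewrite !inE.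
  by rewrite /walk_num (negbTE kc).
have [->|dc] := eqVneq d c; first by rewrite dE {1}/walk_num eqxx subr0.
rewrite -[X in _ - X]/edenom /edenom (epolyT c).
set S := \sum_(_ | _) _.
(* Passing from the range k <> c to k <> d adds the term k = c and removes the term k = d. *)
have -> : S = (epoly (~: [set c]))^`() + (x c)%:P * ('X * (epoly (~: [set c]))^`())
              - (x d)%:P * epoly (~: [set c] :\ d).
  rewrite -{1}dE (bigD1 d) //= /S (bigD1 c) 1?eq_sym //=.
  rewrite {1}/walk_num eqxx {2}/walk_num (negbTE dc).
  under [in RHS]eq_bigl do rewrite andbC.
  by ring.
rewrite /walk_num (negbTE dc) derivM derivD derivM !derivC derivX mul0r !add0r mulr1.
set Q := (epoly (~: [set c]))^`(); rewrite (@epolyD1 (~: [set c]) d) ?inE //.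
by ring.
Qed.

End FiniteVariables.

(** * Compositions and walks *)

(* The compositions of [n], provided [n <= fuel]. *)
Fixpoint comps_rec (fuel n : nat) : seq (seq nat) :=
  if n is n'.+1 then
    if fuel is fuel'.+1 then
      [seq k.+1 :: s | k <- iota 0 n, s <- comps_rec fuel' (n' - k)]
    else [::]
  else [:: [::]].

Definition comps (n : nat) : seq (seq nat) := comps_rec n n.

Lemma comps_recS fuel n : comps_rec fuel.+1 n.+1 =
  [seq k.+1 :: s | k <- iota 0 n.+1, s <- comps_rec fuel (n - k)].
Proof. by []. Qed.

Lemma mem_comps_rec fuel n s :
  (n <= fuel)%N -> (s \in comps_rec fuel n) = is_composition n s.
Proof.
rewrite /is_composition; elim: fuel n s => [|f IH] [|n] s nf.
- by rewrite inE; case: s => [|[|k] s] //=; rewrite addSn andbF.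
- by [].
- by rewrite inE; case: s => [|[|k] s] //=; rewrite addSn andbF.
rewrite comps_recS; apply/idP/idP.
  case/allpairsPdep => k [t [kn tk ->]]; move: tk; rewrite IH; last by lia.
  by move: kn; rewrite mem_iota /=; lia.
case: s => [|[|k] s] // /andP[s1 sn]; rewrite /= in s1 sn.
apply/allpairsPdep; exists k, s; split=> //.
  by rewrite mem_iota; lia.
by rewrite IH ?s1 /=; lia.
Qed.

Lemma mem_comps n s : (s \in comps n) = is_composition n s.
Proof. exact: mem_comps_rec. Qed.

Lemma uniq_comps_rec fuel n : uniq (comps_rec fuel n).
Proof.
elim: fuel n => [|f IH] [|n] //.
rewrite comps_recS; apply: (@allpairs_uniq_dep _ (fun=> seq nat) _ (fun k s => k.+1 :: s)) => //.
- exact: iota_uniq.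
- by move=> [k s] [k' s'] _ _ /= [-> ->].
Qed.

Lemma uniq_comps n : uniq (comps n). Proof. exact: uniq_comps_rec. Qed.

Lemma big_comps0 (V : nmodType) (F : seq nat -> V) :
  \sum_(s <- comps 0) F s = F [::].
Proof. by rewrite big_seq1. Qed.

Lemma big_compsS (V : nmodType) (F : seq nat -> V) n :
  \sum_(s <- comps n.+1) F s =
  \sum_(0 <= k < n.+1) \sum_(s <- comps (n - k)) F (k.+1 :: s).
Proof.
rewrite /comps comps_recS.
rewrite big_allpairs_dep /index_iota subn0; apply: eq_bigr => k _.
(* The two lists are built with different fuel; they are compared as duplicate-free lists with the
   same members. *)
apply: perm_big; apply: uniq_perm; rewrite ?uniq_comps_rec // => s.
by rewrite !mem_comps_rec ?leq_subr.
Qed.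

Section CompSum.
Set Implicit Arguments.
Unset Strict Implicit.
Variables (R : comNzRingType) (e : nat -> R).

Definition comp_sum n : R := \sum_(s <- comps n) \prod_(k <- s) (e k *+ k.-1).

Lemma comp_sum0 : comp_sum 0 = 1.
Proof. by rewrite /comp_sum big_comps0 big_nil. Qed.

(** Splits off the first part. With h_0 = 1 this says that the series of the h_n is inverse to 1 -
    sum_(k >= 1) (k - 1) e_k t^k. *)
Lemma comp_sumS n :
  comp_sum n.+1 = \sum_(k < n.+1) (e k.+1 *+ k) * comp_sum (n - k).
Proof.
rewrite /comp_sum big_compsS big_mkord; apply: eq_bigr => k _.
by rewrite mulr_sumr; apply: eq_bigr => s _; rewrite big_cons.
Qed.

End CompSum.

(** * Words of colors and walks between unequal colors *)

Section Walks.
Set Implicit Arguments.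
Unset Strict Implicit.
Variables (R : comNzRingType) (I : finType) (x : I -> R).
Implicit Types (c d : I) (s : seq I).

Fixpoint words n : seq (seq I) :=
  if n is n'.+1 then [seq k :: s | k <- enum I, s <- words n'] else [:: [::]].

Lemma mem_words n s : (s \in words n) = (size s == n).
Proof.
elim: n s => [|n IH] [|k s] //=.
  by apply/negbTE/negP => /allpairsP[[y t] /= []].
rewrite eqSS -IH; apply/allpairsP/idP => [[[y t] /= [_ ? [_ ->]]] //|sn].
by exists (k, s); rewrite /= mem_enum.
Qed.

Lemma uniq_words n : uniq (words n).
Proof.
elim: n => //= n IH; apply: allpairs_uniq; rewrite ?enum_uniq //.
by move=> [k s] [k' s'] _ _ /= [-> ->].
Qed.

Lemma big_wordsS n (F : seq I -> R) :
  \sum_(s <- words n.+1) F s = \sum_k \sum_(s <- words n) F (k :: s).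
Proof. by rewrite /= big_allpairs_dep big_enum /=. Qed.

Lemma big_wordsD m n (F : seq I -> R) :
  \sum_(s <- words (m + n)) F s =
  \sum_(u <- words m) \sum_(v <- words n) F (u ++ v).
Proof.
elim: m F => [|m IH] F; first by rewrite big_seq1.
by rewrite addSn !big_wordsS; apply: eq_bigr => k _; exact: IH.
Qed.

Definition neq_rel : rel I := [rel i j | i != j].

(** Only the m interior vertices carry weight, so a closed walk at c is a coloring of a cycle on m +
    1 vertices with the factor x_c of one vertex left out. *)
Definition walk_sum m d c : R :=
  \sum_(s <- words m | path neq_rel d (rcons s c)) \prod_(k <- s) x k.

Lemma walk_sum0 d c : walk_sum 0 d c = (d != c)%:R.
Proof.
rewrite /walk_sum big_mkcond big_seq1 /= andbT big_nil.
by rewrite -[neq_rel d c]/(d != c); case: (d != c).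
Qed.

Lemma walk_sumS m d c :
  walk_sum m.+1 d c = \sum_(k | k != d) x k * walk_sum m k c.
Proof.
rewrite /walk_sum big_mkcond big_wordsS [RHS]big_mkcond; apply: eq_bigr => k _.
rewrite -big_mkcond /= -[neq_rel d k]/(d != k) (eq_sym k d).
case: (d != k) => /=; last by rewrite big_pred0_eq.
by rewrite mulr_sumr; apply: eq_bigr => s _; rewrite big_cons.
Qed.

Local Notation h := (comp_sum (esymv x)).

(** Coefficient form of [walk_num] / D, the h_n being the coefficients of 1/D; the induction on m
    follows the first step of the walk. *)
Lemma walk_sumE m d c :
  walk_sum m d c = \sum_(k < m.+1) h (m - k) * (walk_num x d c)`_k.
Proof.
have Dk k : (edenom x)`_k = esymv x k - (esymv x k) *+ k.
  rewrite coefB coefXM /esymv; case: k => [|k] /=; first by rewrite subr0.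
  by rewrite coef_deriv.
have D0 : (edenom x)`_0 = 1 by rewrite Dk esymv0 subr0.
(* D times 1/D has no term of positive degree. *)
have hD n : \sum_(k < n.+2) h (n.+1 - k) * (edenom x)`_k = 0.
  rewrite big_ord_recl subn0 D0 mulr1 comp_sumS -big_split big1 //= => k _.
  by rewrite Dk /bump add1n subSS mulrS; ring.
have rec i j k : (\sum_(l | l != i) (x l)%:P * walk_num x l j)`_k =
    (walk_num x i j)`_k.+1 - (edenom x)`_k.+1 *+ (i != j).
  have := congr1 (fun p : {poly R} => p`_k.+1) (walk_num_rec x i j).
  by rewrite coefXM /= coefB coefMn.
have N0 i j : (walk_num x i j)`_0 = (i != j)%:R.
  have := congr1 (fun p : {poly R} => p`_0) (walk_num_rec x i j).
  rewrite coefXM /= coefB coefMn D0 => /eqP.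
  by rewrite eq_sym subr_eq add0r => /eqP.
elim: m d => [|m IH] d.
  by rewrite walk_sum0 big_ord1 comp_sum0 mul1r N0.
rewrite walk_sumS.
transitivity (\sum_(k < m.+1) h (m - k) *
               (\sum_(l | l != d) (x l)%:P * walk_num x l c)`_k).
  under eq_bigr do rewrite IH mulr_sumr.
  rewrite exchange_big /=; apply: eq_bigr => k _.
  rewrite coef_sum mulr_sumr; apply: eq_bigr => l _.
  by rewrite coefCM mulrCA.
(* [hD] expresses h_(m+1), the cofactor of the constant term of [walk_num], by lower h; the result
   matches the [edenom] correction in [rec]. *)
have := hD m; rewrite big_ord_recl subn0 D0 mulr1 => /eqP.
rewrite addr_eq0 => /eqP hS.
rewrite [RHS]big_ord_recl subn0 N0 hS mulNr mulr_suml addrC -sumrB.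
apply: eq_bigr => k _; rewrite rec lift0 subSS.
by case: (d != c); rewrite /= ?mulr1n ?mulr0n; ring.
Qed.

(** The diagonal numerator is t times a derivative, hence the factors k r_k; this is G_(m+1)(c) of
    the overview. *)
Lemma closed_walk_sumE m c : walk_sum m c c =
  \sum_(k < m.+1) h (m - k) * (esymvD x c k *+ k).
Proof.
rewrite walk_sumE; apply: eq_bigr => k _; congr (_ * _).
rewrite /walk_num eqxx coefXM; case: (k : nat) => [|l] //=.
by rewrite coef_deriv.
Qed.

Lemma sum_closed_walks m n :
  \sum_c x c * walk_sum m c c * walk_sum n c c =
  \sum_(j < m.+1) \sum_(k < n.+1)
     h (m - j) * h (n - k) * esymvD2 x j k *+ (j * k).
Proof.
transitivity (\sum_c \sum_(j < m.+1) \sum_(k < n.+1)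
   h (m - j) * h (n - k) * (x c * esymvD x c j * esymvD x c k) *+ (j * k)).
  apply: eq_bigr => c _; rewrite !closed_walk_sumE -mulrA mulr_suml mulr_sumr.
  apply: eq_bigr => j _; rewrite mulr_sumr mulr_sumr; apply: eq_bigr => k _.
  by rewrite mulrnA; ring.
rewrite exchange_big; apply: eq_bigr => j _.
rewrite exchange_big; apply: eq_bigr => k _.
by rewrite /esymvD2 mulr_sumr sumrMnl.
Qed.

End Walks.

(** * Colorings of two cycles sharing a vertex *)

Section Colorings.
Set Implicit Arguments.
Unset Strict Implicit.
Variables (R : comNzRingType) (I : finType) (x : I -> R).

Lemma nth_codom_ord k (T : Type) (t0 : T) (f : 'I_k -> T) (i : 'I_k) :
  nth t0 (codom f) i = f i.
Proof. by rewrite codomE (nth_map i) ?size_enum_ord // nth_ord_enum. Qed.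

Lemma sum_ffun_words k (F : seq I -> R) :
  (0 < k)%N ->
  \sum_(kappa : {ffun 'I_k -> I}) F (codom kappa) = \sum_(s <- words I k) F s.
Proof.
move=> k0; rewrite -big_enum /=.
rewrite -(big_map (fun kappa : {ffun 'I_k -> I} => codom kappa) xpredT F).
apply: perm_big; apply: uniq_perm.
- rewrite map_inj_uniq ?enum_uniq // => f g fg; apply/ffunP => i.
  by rewrite -(nth_codom_ord (f i) f) fg nth_codom_ord.
- exact: uniq_words.
move=> s; rewrite mem_words; apply/mapP/eqP => [[f _ ->]|sk].
  by rewrite size_codom card_ord.
case: s sk => [|c s] sk; first by rewrite -sk in k0.
exists [ffun i : 'I_k => nth c (c :: s) i]; first by rewrite mem_enum.
apply: (@eq_from_nth _ c) => [|i]; first by rewrite size_codom card_ord.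
rewrite sk => ik; rewrite -[i]/(val (Ordinal ik)).
by rewrite nth_codom_ord ffunE.
Qed.

(** [cycle] appends the head t to the tail s, and entry i of [rcons s t] is entry [ordS i] of the
    original word. *)
Lemma cycle_nthP (T : Type) (e : rel T) (t0 : T) n (s : seq T) :
  size s = n.+1 ->
  reflect (forall i : 'I_n.+1, e (nth t0 s i) (nth t0 s (ordS i))) (cycle e s).
Proof.
case: s => // t s [sn] /=; rewrite -sn.
have E (i : 'I_(size s).+1) : nth t0 (t :: s) (ordS i) = nth t0 (rcons s t) i.
  rewrite nth_rcons /=; have [lt|ge] := ltnP i (size s).
    by rewrite modn_small.
  have -> : (i : nat) = size s by have := ltn_ord i; lia.
  by rewrite eqxx modnn.
apply: (iffP (pathP t0)) => [H i|H i].
  have := H i; rewrite size_rcons ltn_ord => /(_ isT).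
  by rewrite E -rcons_cons nth_rcons ltn_ord.
rewrite size_rcons => li.
have -> : nth t0 (t :: rcons s t) i = nth t0 (t :: s) i.
  by rewrite -rcons_cons nth_rcons /= li.
by have := H (Ordinal li); rewrite E.
Qed.

Definition is_coloring k (e : rel 'I_k) (kappa : {ffun 'I_k -> I}) :=
  [forall u, forall v, e u v ==> (kappa u != kappa v)].

(** The shared vertex has index m, last in the first cycle and first in the second, so the two
    subwords overlap in exactly that entry. *)
Lemma is_coloring_glueE m n
    (kappa : {ffun 'I_(m.+1 + n.+1).-1 -> I}) :
  is_coloring (glue_graph (cycle_graph m.+1) (cycle_graph n.+1)) kappa =
  cycle (@neq_rel I) (take m.+1 (codom kappa)) &&
  cycle (@neq_rel I) (drop m (codom kappa)).
Proof.
have sz : size (codom kappa) = (m + n.+1)%N by rewrite size_codom card_ord.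
have lk : (0 < (m.+1 + n.+1).-1)%N by lia.
have c0 := kappa (Ordinal lk).
have sz1 : size (take m.+1 (codom kappa)) = m.+1 by rewrite size_takel ?sz; lia.
have sz2 : size (drop m (codom kappa)) = n.+1 by rewrite size_drop sz; lia.
have lt1 (i : 'I_m.+1) : (i < (m.+1 + n.+1).-1)%N by have := ltn_ord i; lia.
have lt2 (i : 'I_n.+1) : (i + m < (m.+1 + n.+1).-1)%N by have := ltn_ord i; lia.
have nth1 (i : 'I_m.+1) : nth c0 (take m.+1 (codom kappa)) i = kappa (Ordinal (lt1 i)).
  by rewrite nth_take // -(nth_codom_ord c0 kappa).
have nth2 (i : 'I_n.+1) : nth c0 (drop m (codom kappa)) i = kappa (Ordinal (lt2 i)).
  by rewrite nth_drop [(m + _)%N]addnC -(nth_codom_ord c0 kappa).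
apply/idP/andP => [col|[/(cycle_nthP _ c0 sz1) H1 /(cycle_nthP _ c0 sz2) H2]].
  have {}col u v := forallP (forallP col u) v.
  split; [apply/(cycle_nthP _ c0 sz1)|apply/(cycle_nthP _ c0 sz2)] => i.
    rewrite !nth1; apply: (implyP (col _ _)); apply/orP; left.
    by apply/existsP; exists i; apply/existsP; exists (ordS i); apply/and3P; split => //; apply/orP; left.
  rewrite !nth2; apply: (implyP (col _ _)); apply/orP; right.
  by apply/existsP; exists i; apply/existsP; exists (ordS i); apply/and3P; split => //; apply/orP; left.
apply/forallP => u; apply/forallP => v; apply/implyP => /orP[].
  case/existsP=> i /existsP[j] /and3P[/orP ij /eqP ui /eqP vj].
  have -> : u = Ordinal (lt1 i) by exact: val_inj.
  have -> : v = Ordinal (lt1 j) by exact: val_inj.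
  (* The edge may run along the cycle in either direction; inequality of colors is symmetric. *)
  by case: ij => /eqP->; [|rewrite eq_sym]; have := H1; rewrite -!nth1; apply.
case/existsP=> i /existsP[j] /and3P[/orP ij /eqP ui /eqP vj].
have -> : u = Ordinal (lt2 i) by exact: val_inj.
have -> : v = Ordinal (lt2 j) by exact: val_inj.
by case: ij => /eqP->; [|rewrite eq_sym]; have := H2; rewrite -!nth2; apply.
Qed.

(** Cut the color word at the shared vertex as u ++ c :: v. Rotating the first cycle to c :: u turns
    both conditions into closed walks at c, and x_c is counted once. *)
Lemma sum_glue_colorings m n :
  \sum_(kappa | is_coloring (glue_graph (cycle_graph m.+1) (cycle_graph n.+1))
                  kappa) \prod_v x (kappa v) =
  \sum_c x c * walk_sum x m c c * walk_sum x n c c.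
Proof.
pose F s := if cycle (@neq_rel I) (take m.+1 s) && cycle (@neq_rel I) (drop m s)
            then \prod_(k <- s) x k else 0.
rewrite big_mkcond /=.
transitivity (\sum_(kappa : {ffun 'I_(m.+1 + n.+1).-1 -> I}) F (codom kappa)).
  apply: eq_bigr => kappa _; rewrite is_coloring_glueE /F.
  by rewrite codomE big_map big_enum.
rewrite sum_ffun_words; last by lia.
rewrite -[(m.+1 + n.+1).-1]/(m + n.+1)%N big_wordsD.
transitivity (\sum_(u <- words I m) \sum_c \sum_(v <- words I n)
                F (u ++ c :: v)).
  by apply: eq_bigr => u _; rewrite big_wordsS.
rewrite exchange_big /=; apply: eq_bigr => c _.
rewrite {1}/walk_sum mulr_sumr mulr_suml [RHS]big_mkcond /=.
rewrite big_seq [RHS]big_seq; apply: eq_bigr => u; rewrite mem_words => /eqP um.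
under eq_bigr => v _.
  rewrite /F -cat_rcons take_size_cat ?size_rcons ?um //.
  rewrite cat_rcons drop_size_cat // -rot1_cons rot_cycle.
  rewrite -[cycle _ (c :: u)]/(path _ c (rcons u c)).
  rewrite -[cycle _ (c :: v)]/(path _ c (rcons v c)) big_cat big_cons /=.
  over.
case: (path _ c (rcons u c)) => /=; last by rewrite big1.
rewrite /walk_sum mulr_sumr [RHS]big_mkcond; apply: eq_bigr => v _.
by case: ifP => // _; ring.
Qed.

End Colorings.

(** * The sum over pairs of compositions *)

Lemma prod_pred_from1 s : prod_pred_from 1 s = \prod_(k <- s) (k%:Z - 1).
Proof. by rewrite /prod_pred_from big_add1 [RHS](big_nth 0%N). Qed.

Lemma prod_pred_from3 b1 b2 s :
  prod_pred_from 3 [:: b1, b2 & s] = \prod_(k <- s) (k%:Z - 1).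
Proof. by rewrite /prod_pred_from !big_add1 [RHS](big_nth 0%N). Qed.

Section CompositionPairs.
Set Implicit Arguments.
Unset Strict Implicit.

Definition comp_pair_cond (al be : seq nat) : bool :=
  [&& (2 <= size be)%N, (part be 1 <= part al 1)%N & (part al 1 <= part be 2)%N].

(** A duplicate-free listing of the index set, which turns the finitely supported sum of the theorem
    into a sum over a list. *)
Definition comp_pairs a b : seq (seq nat * seq nat) :=
  [seq (al, be) | al <- comps a,
                  be <- [seq be <- comps (b + part al 1) | comp_pair_cond al be]].

Lemma uniq_comp_pairs a b : uniq (comp_pairs a b).
Proof.
apply: (@allpairs_uniq_dep _ (fun=> seq nat)); rewrite ?uniq_comps //.
- by move=> al _; rewrite filter_uniq ?uniq_comps.
- by move=> [? ?] [? ?] _ _ /= [-> ->].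
Qed.

Lemma mem_comp_pairs a b al be : (al, be) \in comp_pairs a b <->
  [/\ is_composition a al, is_composition (b + part al 1) be,
      (2 <= size be)%N, (part be 1 <= part al 1)%N & (part al 1 <= part be 2)%N].
Proof.
split=> [/allpairsPdep[s [t [+ + [-> ->]]]]|[ca cb h1 h2 h3]].
  by rewrite mem_filter !mem_comps => -> /andP[/and3P[-> -> ->] ->].
apply/allpairsPdep; exists al, be.
by rewrite mem_filter !mem_comps ca cb /comp_pair_cond h1 h2 h3.
Qed.

Variables (R : comNzRingType) (e : nat -> R).
Local Notation h := (comp_sum e).

(** Stated for any ring and sequence e, so that it applies after truncation; the product makes
    sorting irrelevant. *)
Definition comp_pair_term (al be : seq nat) : R :=
  (\prod_(k <- behead al ++ behead be ++ [:: (part be 1).-1]) e k) *~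
    (prod_pred_from 1 al
        * (((part be 2)%:Z - (part be 1)%:Z + 1)
           * ((part be 1)%:Z + (part be 2)%:Z - (part al 1)%:Z - 1))
        * prod_pred_from 3 be).

(** Parts are positive, so the natural number [k.-1] agrees with the integer k - 1. *)
Lemma comp_sumE n :
  h n = \sum_(s <- comps n) (\prod_(k <- s) e k) * (\prod_(k <- s) (k%:Z - 1))%:~R.
Proof.
rewrite /comp_sum big_seq [RHS]big_seq; apply: eq_bigr => s.
rewrite mem_comps => /andP[+ _]; elim: s => [|[|k] s IH] //=.
  by rewrite !big_nil mulr1.
move=> /IH {}IH; rewrite !big_cons IH intrM.
have -> : k.+1%:Z - 1 = k by lia.
by rewrite -mulr_natr; ring.
Qed.

(** With alpha_1 = j + 1, beta_1 = i + 1 and beta_2 = l + 1, the inequalities become i <= j and j <=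
    l. *)
Lemma big_comps_pairs (V : nmodType) (F : seq nat -> V) n j al :
  \sum_(be <- comps (n.+1 + j.+1) | comp_pair_cond (j.+1 :: al) be) F be =
  \sum_(0 <= i < j.+1) \sum_(j <= l < (n + j - i).+1)
    \sum_(be <- comps (n + j - i - l)) F [:: i.+1, l.+1 & be].
Proof.
rewrite big_mkcond addnS big_compsS.
rewrite (@big_nat_widen _ _ _ 0 j.+1 (n.+1 + j).+1); last by lia.
rewrite [RHS]big_mkcond /=; apply: eq_bigr => i _; rewrite ltnS.
case: leqP => [ij|ji]; last first.
  rewrite big1 // => s _; rewrite /comp_pair_cond /part /=.
  by case: ifP => // /and3P[_]; rewrite ltnS leqNgt ji.
(* For i <= j the remainder after the first part is positive, so a second part exists. *)
have -> : (n.+1 + j - i = (n + j - i).+1)%N by lia.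
rewrite big_compsS (@big_nat_widenl _ _ _ j 0) // [RHS]big_mkcond /=.
apply: eq_bigr => l _; rewrite /comp_pair_cond /part /= !ltnS ij /=.
by case: leqP => // _; rewrite big1.
Qed.

Lemma sum_comp_pairs m n :
  \sum_(p <- comp_pairs m.+1 n.+1) comp_pair_term p.1 p.2 =
  \sum_(j < m.+1) \sum_(k < n.+1)
    h (m - j) * h (n - k) *
    (\sum_(i < (minn j k).+1)
       e (j + k - i).+1 * e i * ((j + k).+1%:R - i.*2%:R)) *+ (j * k).
Proof.
rewrite big_allpairs_dep big_compsS big_mkord; apply: eq_bigr => j _ /=.
under eq_bigr do rewrite big_filter big_comps_pairs.
transitivity (\sum_(al <- comps (m - j)) \sum_(0 <= i < j.+1)
  \sum_(i <= k < n.+1) \sum_(be <- comps (n - k))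
  ((\prod_(p <- al) e p) * (\prod_(p <- al) (p%:Z - 1))%:~R) *
  (((\prod_(p <- be) e p) * (\prod_(p <- be) (p%:Z - 1))%:~R) *
   (e (j + k - i).+1 * e i * ((j + k).+1%:R - i.*2%:R) * (j * k)%:R))).
  apply: eq_bigr => al _; apply: eq_big_nat => i /andP[_ ij].
  (* The new index k = l - (j - i) equals beta_1 + beta_2 - alpha_1 - 1, one of the weights; the
     other parts of beta then form a composition of n - k. *)
  have -> : \sum_(j <= l < (n + j - i).+1)
      \sum_(be <- comps (n + j - i - l))
         comp_pair_term (j.+1 :: al) [:: i.+1, l.+1 & be] =
    \sum_(i <= k < n.+1) \sum_(be <- comps (n + j - i - (k + (j - i))))
         comp_pair_term (j.+1 :: al) [:: i.+1, (k + (j - i)).+1 & be].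
    rewrite [in RHS](_ : n.+1 = (n + j - i).+1 - (j - i))%N; last by lia.
    by rewrite -(big_addn i _ (j - i) xpredT (fun l =>
        \sum_(be <- comps (n + j - i - l))
          comp_pair_term (j.+1 :: al) [:: i.+1, l.+1 & be])) subnKC.
  apply: eq_big_nat => k /andP[ik kn].
  rewrite (_ : (n + j - i - (k + (j - i)) = n - k)%N); last by lia.
  apply: eq_bigr => be _; rewrite /comp_pair_term /part /=.
  rewrite prod_pred_from1 prod_pred_from3 !(big_cat, big_cons, big_nil) /=.
  rewrite (_ : (k + (j - i) = j + k - i)%N); last by lia.
  rewrite (_ : (j + k - i).+1%:Z - i.+1%:Z + 1 = (j + k).+1%:Z - i.*2%:Z); last by lia.
  rewrite (_ : i.+1%:Z + (j + k - i).+1%:Z - j.+1%:Z - 1 = k%:Z); last by lia.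
  rewrite (_ : j.+1%:Z - 1 = j%:Z); last by lia.
  by rewrite -mulrzr !intrM intrB -!pmulrn natrM; ring.
pose C i k := e (j + k - i).+1 * e i * ((j + k).+1%:R - i.*2%:R) * (j * k)%:R.
transitivity (h (m - j) *
    \sum_(0 <= i < j.+1) \sum_(i <= k < n.+1) h (n - k) * C i k).
  rewrite comp_sumE mulr_suml; apply: eq_bigr => al _.
  rewrite mulr_sumr; apply: eq_bigr => i _.
  rewrite mulr_sumr; apply: eq_bigr => k _.
  by rewrite -mulr_sumr -mulr_suml -comp_sumE.
(* The constraints i <= j and i <= k <= n are read with k outermost. *)
transitivity (h (m - j) *
    \sum_(0 <= k < n.+1) \sum_(0 <= i < (minn j k).+1) h (n - k) * C i k).
  congr (_ * _).
  transitivity (\sum_(0 <= i < j.+1) \sum_(0 <= k < n.+1)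
                  if (i <= k)%N then h (n - k) * C i k else 0).
    by apply: eq_bigr => i _; rewrite (@big_nat_widenl _ _ _ i 0) // big_mkcond.
  rewrite exchange_big /=; apply: eq_bigr => k _.
  rewrite (@big_nat_widen _ _ _ 0 (minn j k).+1 j.+1); last by lia.
  rewrite -big_mkcond /= big_nat_cond [RHS]big_nat_cond; apply: eq_bigl => i.
  by lia.
rewrite big_mkord mulr_sumr; apply: eq_bigr => k _.
by rewrite big_mkord -mulr_sumr /C -mulr_suml -[RHS]mulr_natr !mulrA.
Qed.

End CompositionPairs.

(** * Reduction to finitely many variables *)

Section Truncation.
Local Open Scope mset_scope.
Local Open Scope classical_set_scope.
Local Open Scope ring_scope.
Set Implicit Arguments.
Unset Strict Implicit.
Implicit Types (N : nat) (f g : fps) (m A B : {mset nat}).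

Definition mset_below N m : bool := all (fun i => (i < N)%N) (m : seq nat).

Lemma mset_belowP N m :
  reflect (forall i, i \in m -> (i < N)%N) (mset_below N m).
Proof. exact: allP. Qed.

Lemma mset_belowD N A B :
  mset_below N (A `+` B)%mset = mset_below N A && mset_below N B.
Proof.
apply/mset_belowP/andP => [H|[/mset_belowP HA /mset_belowP HB] i].
  by split; apply/mset_belowP => i im; apply: H; rewrite in_msetD im ?orbT.
by rewrite in_msetD => /orP[/HA|/HB].
Qed.

(* Setting the variables x_i, i >= N, to zero. *)
Definition trunc N f : fps := fun m => if mset_below N m then f m else 0.

Lemma truncB N : {morph trunc N : f g / f - g}.
Proof.
move=> f g; apply/funext => m; rewrite /trunc.
rewrite [RHS]/GRing.add /= [in RHS]/GRing.opp /=.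
by case: ifP => // _; rewrite subr0.
Qed.

Lemma trunc1 N : trunc N 1 = 1.
Proof.
apply/funext => m; rewrite /trunc; case: mset_belowP => // nm.
rewrite [RHS]/(fps_one m) /fps_one; case: eqP => // m0.
by case: nm => i; rewrite m0 in_mset0.
Qed.

(** A product of monomials avoids the variables x_i, i >= N, exactly when both factors do. *)
Lemma truncM N : {morph trunc N : f g / f * g}.
Proof.
move=> f g; apply/funext => m.
rewrite [RHS](fps_mulE _ _ (submsets_id m)).
have E : \sum_(A <- submsets m)
    \sum_(B <- submsets m | (A `+` B)%mset == m) trunc N f A * trunc N g B =
  \sum_(A <- submsets m) \sum_(B <- submsets m | (A `+` B)%mset == m)
    if mset_below N m then f A * g B else 0.
  apply: eq_bigr => A _; apply: eq_bigr => B /eqP <-.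
  rewrite mset_belowD /trunc.
  by case: ifP => _ /=; case: ifP => _; rewrite ?(mul0r, mulr0).
rewrite {}E /trunc; case: ifP => _.
  by rewrite -[f * g]/(fps_mul f g) (fps_mulE _ _ (submsets_id m)).
by rewrite big1 // => A _; rewrite big1.
Qed.

HB.instance Definition _ N :=
  GRing.isZmodMorphism.Build fps fps (trunc N) (truncB N).
HB.instance Definition _ N :=
  GRing.isMonoidMorphism.Build fps fps (trunc N) (trunc1 N, truncM N).

(** Each monomial survives once N exceeds its largest index. *)
Lemma trunc_inj f g : (forall N, trunc N f = trunc N g) -> f = g.
Proof.
move=> fg; apply/funext => m.
have := congr1 (fun u : fps => u m) (fg (\max_(i <- (m : seq nat)) i).+1).
rewrite /trunc; case: mset_belowP => // -[] i im.
by rewrite ltnS; exact: leq_bigmax_seq.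
Qed.

Lemma fps_sumE (J : Type) (s : seq J) (P : pred J) (F : J -> fps) m :
  (\sum_(i <- s | P i) F i) m = \sum_(i <- s | P i) F i m.
Proof. exact: (big_morph (fun f : fps => f m)). Qed.

(** Members outside s have zero coefficient at every monomial below N, so there the finitely
    supported sum reduces to s. *)
Lemma trunc_fps_sum N (J : choiceType) (D : set J) (F : J -> fps) (s : seq J) :
  uniq s -> (forall i, i \in s -> D i) ->
  (forall i, D i -> i \notin s -> trunc N (F i) = 0) ->
  trunc N (fps_sum D F) = \sum_(i <- s) trunc N (F i).
Proof.
move=> us sD F0; apply/funext => m; rewrite fps_sumE /trunc /fps_sum.
case: ifP => [mN|_]; last by rewrite big1.
rewrite (fsbig_seq _ _ us); apply/esym/fsbig_widen => [i /sD //|i [/= Di /negP si]].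
have := congr1 (fun u : fps => u m) (F0 i Di si).
by rewrite /trunc mN.
Qed.

Definition monomial A : fps := fun m => (m == A)%:R.

Lemma monomialM A B : monomial A * monomial B = monomial (A `+` B)%mset.
Proof.
apply/funext => m; rewrite [LHS]/(fps_mul _ _ m) /fps_mul /monomial.
case: eqP => [->|mAB].
  rewrite -(@fsbig_widen _ _ _ _ [set (A, B)]) /=.
  - by rewrite fsbig_set1 /= !eqxx mulr1.
  - by move=> _ ->.
  move=> [A' B'] /= [_ AB]; case: eqP => [EA|]; last by rewrite mul0r.
  by case: eqP => [EB|]; rewrite ?mulr0 //; case: AB; rewrite EA EB.
rewrite fsbig1 // => -[A' B'] /= AB.
case: eqP => [EA|]; last by rewrite mul0r.
case: eqP => [EB|]; last by rewrite mulr0.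
by case: mAB; rewrite -EA -EB.
Qed.

Lemma prod_fps_var (s : seq nat) : \prod_(i <- s) fps_var i = monomial (seq_mset s).
Proof.
elim: s => [|i s IH].
  rewrite big_nil; apply/funext => m; rewrite /monomial [LHS]/(fps_one m).
  by congr (_ == _)%:R; apply/msetP => j; rewrite mset_seqE mset0E.
rewrite big_cons IH monomialM; congr monomial; apply/msetP => j.
by rewrite mset1DE !mset_seqE /= eq_sym.
Qed.

Lemma trunc_prod_fps_var N (s : seq nat) :
  trunc N (\prod_(i <- s) fps_var i) =
  if all (fun i => (i < N)%N) s then \prod_(i <- s) fps_var i else 0.
Proof.
rewrite prod_fps_var; apply/funext => m; rewrite /trunc /monomial.
have -> : all (fun i => (i < N)%N) s = mset_below N (seq_mset s).
  by rewrite /mset_below (perm_all _ (perm_eq_seq_mset s)).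
have [->|/eqP ms] := eqVneq m (seq_mset s); first by case: ifP => //= _; rewrite eqxx.
by case: ifP => _; case: ifP => _ //=; case: eqP.
Qed.

Definition tvar N (i : 'I_N) : fps := fps_var i.

(** Expanding the product, J records the factors that contribute x_i t instead of 1. *)
Lemma esymv_sum (R : comNzRingType) (I : finType) (x : I -> R) k :
  esymv x k = \sum_(J : {set I} | #|J| == k) \prod_(i in J) x i.
Proof.
rewrite /esymv /epoly; under eq_bigl do rewrite finset.in_setT.
under eq_bigr do rewrite addrC.
rewrite bigA_distr coef_sum [RHS]big_mkcond; apply: eq_bigr => J _.
rewrite -big_mkcond /= big_split /= -rmorph_prod /= coefCM prodr_const coefXn.
by rewrite eq_sym; case: eqP; rewrite ?mulr1 ?mulr0.
Qed.

(** The surviving index sets are the k-subsets of {0, ..., N-1}, transported by [im] from sets of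
    ordinals. *)
Lemma trunc_elem N k : trunc N (elem k) = esymv (@tvar N) k.
Proof.
pose im (J : {set 'I_N}) : {fset nat} := [fset val i | i in J]%fset.
have im_inj : injective im.
  move=> J K JK; apply/setP => i; have := congr1 (fun X => val i \in X) JK.
  by rewrite !mem_imfset //; exact: val_inj.
have imK (X : {fset nat}) : all (fun i => (i < N)%N) X ->
    X = im [set i : 'I_N | val i \in X]%SET.
  move=> /allP XN; apply/fsetP => i; apply/idP/imfsetP => [iX|[j /=]].
    by exists (Ordinal (XN i iX)); rewrite //= inE.
  by rewrite inE => jX ->.
have card_im J : #|` im J|%fset = #|J|.
  by rewrite card_imfset ?cardE //; exact: val_inj.
rewrite /elem (@trunc_fps_sum _ _ _ _
  [seq im J | J : {set 'I_N} <- enum {set 'I_N} & #|J| == k]).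
- rewrite esymv_sum big_map big_filter big_enum_cond /=; apply: eq_bigr => J _.
  rewrite trunc_prod_fps_var ifT.
    by rewrite big_imfset /= ?big_enum // => i j _ _; exact: val_inj.
  by apply/allP => ? /imfsetP[j _ ->]; exact: ltn_ord.
- by rewrite map_inj_uniq // filter_uniq // enum_uniq.
- by move=> _ /mapP[J + ->] /=; rewrite mem_filter card_im => /andP[/eqP].
move=> X /= Xk Xs; rewrite trunc_prod_fps_var; case: ifP => // /imK XE.
case/mapP: Xs; exists [set i : 'I_N | val i \in X]%SET; last by [].
by rewrite mem_filter mem_enum andbT -card_im -XE Xk.
Qed.

(** The surviving colorings are those using only colors below N. *)
Lemma trunc_chromatic_sym N k (e : rel 'I_k) :
  trunc N (chromatic_sym e) =
  \sum_(kappa : {ffun 'I_k -> 'I_N} | is_coloring e kappa)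
     \prod_v tvar (kappa v).
Proof.
pose im (kappa : {ffun 'I_k -> 'I_N}) : {ffun 'I_k -> nat} :=
  [ffun v => val (kappa v)].
have im_inj : injective im.
  move=> f g /ffunP fg; apply/ffunP => v; have := fg v.
  by rewrite !ffunE; exact: val_inj.
rewrite /chromatic_sym (@trunc_fps_sum _ _ _ _
  [seq im kappa | kappa <- enum {ffun 'I_k -> 'I_N} & is_coloring e kappa]).
- rewrite big_map big_filter big_enum_cond /=; apply: eq_bigr => f _.
  under [X in trunc N X]eq_bigr do rewrite ffunE.
  rewrite rmorph_prod; apply: eq_bigr => v _.
  have := trunc_prod_fps_var N [:: val (f v)].
  by rewrite !big_seq1 /= ltn_ord.
- by rewrite map_inj_uniq // filter_uniq // enum_uniq.
- move=> _ /mapP[f + ->] /=; rewrite mem_filter => /andP[/forallP fc _] u v uv.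
  by rewrite !ffunE; have /forallP/(_ v)/implyP/(_ uv) := fc u.
move=> f /= fc fs.
rewrite -(big_map f xpredT fps_var) trunc_prod_fps_var.
case: ifP => // /allP fN; case/negP: fs.
have lt v : (f v < N)%N by apply/fN/map_f; rewrite mem_index_enum.
have fE : f = im [ffun v => Ordinal (lt v)].
  by apply/ffunP => v; rewrite !ffunE.
rewrite fE map_f // mem_filter mem_enum andbT.
apply/forallP => u; apply/forallP => v; apply/implyP => /fc.
by rewrite !ffunE.
Qed.

End Truncation.

Theorem mainTheorem4 (a b : nat) (ha : (2 <= a)%N) (hb : (2 <= b)%N) :
  chromatic_sym (glue_graph (cycle_graph a) (cycle_graph b)) =
  \sum_(ab \in [set ab : seq nat * seq nat |
                 let: (al, be) := ab in
                 [/\ is_composition a al,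
                     is_composition (b + part al 1) be,
                     (2 <= size be)%N,
                     (part be 1 <= part al 1)%N &
                     (part al 1 <= part be 2)%N]])
    (let: (al, be) := ab in
     elem_part (sort geq (behead al ++ behead be ++ [:: (part be 1).-1])) *~
       (prod_pred_from 1 al
        * (((part be 2)%:Z - (part be 1)%:Z + 1)
           * ((part be 1)%:Z + (part be 2)%:Z - (part al 1)%:Z - 1))
        * prod_pred_from 3 be)).
Proof.
case: a ha => // m _; case: b hb => // n _.
set S := [set _ | _].
have -> : S = [set` comp_pairs m.+1 n.+1].
  by apply/seteqP; split => -[al be] /mem_comp_pairs.
rewrite -fsbig_seq ?uniq_comp_pairs //.
apply: trunc_inj => N; rewrite trunc_chromatic_sym sum_glue_colorings.
rewrite sum_closed_walks rmorph_sum /=.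
transitivity (\sum_(p <- comp_pairs m.+1 n.+1)
                comp_pair_term (esymv (@tvar N)) p.1 p.2); last first.
  apply: eq_bigr => -[al be] _ /=; rewrite rmorphMz /comp_pair_term /elem_part.
  congr (_ *~ _); rewrite (perm_big _ (permEl (perm_sort _ _))) rmorph_prod.
  by apply: eq_bigr => k _; rewrite /= trunc_elem.
rewrite sum_comp_pairs; apply: eq_bigr => j _; apply: eq_bigr => k _.
congr (_ * _ *+ _).
(* [esymvD2E] sums up to its second index; the symmetry in j and k makes that index the minimum. *)
have [jk|/ltnW jk] := leqP k j; first by rewrite esymvD2E.
by rewrite esymvD2C esymvD2E addnC.
Qed.
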